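(* Let $\mathcal{H}_A\otimes\mathcal{H}_B$ be a finite-dimensional bipartite Hilbert space. Every pure product state $|\Psi\rangle\in\mathcal{H}_A\otimes\mathcal{H}_B$ can be verified by a strategy that uses one measurement setting (based on nonadaptive local projective measurements). Every pure entangled state $|\Psi\rangle\in\mathcal{H}_A\otimes\mathcal{H}_B$ can be verified by a strategy that uses two measurement settings, but cannot be verified by any strategy that uses only one measurement setting.
   Context: Verification of a pure state $|\Psi\rangle$: a test is a two-outcome measurement $\{E,I-E\}$ with $0\le E\le I$ and $E|\Psi\rangle=|\Psi\rangle$ (the first outcome means ''pass''). A strategy performs test $E_l$ with probability $p_l>0$; its verification operator is $\Omega=\sum_l p_lE_l$. The strategy verifies $|\Psi\rangle$ iff the spectral gap $\nu(\Omega)=1-\beta(\Omega)$ is positive, where $\beta(\Omega)$ is the second largest eigenvalue of $\Omega$ (counted with multiplicity). Tests are realized by nonadaptive local projective measurements: a measurement setting is a choice of one projective measurement $\{A_i\}$ for Alice and one projective measurement $\{B_j\}$ for Bob, performed independently; a test realized by this setting has test operator $E=\sum_{(i,j)\in S}A_i\otimes B_j$ for some accepted set $S$ of outcome pairs. The number of measurement settings of a strategy is the number of distinct settings needed to realize all its tests. *)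

(* Defs.v *)
From HB Require Import structures.
From mathcomp Require Import all_boot all_order all_algebra.
From mathcomp Require Import complex mxtens.
Set Implicit Arguments. Unset Strict Implicit. Unset Printing Implicit Defensive.
Import Order.TTheory GRing.Theory Num.Theory.
Local Open Scope ring_scope.

Section Verification.
Variable R : rcfType.
Local Notation C := (R[i]).

Definition adjmx m n (A : 'M[C]_(m, n)) : 'M[C]_(n, m) :=
  \matrix_(i, j) (A j i)^*.

Definition hermitian n (A : 'M[C]_n) : Prop := adjmx A = A.

Definition psd n (A : 'M[C]_n) : Prop :=
  hermitian A /\ forall v : 'cV[C]_n, 0 <= (adjmx v *m A *m v) 0 0.

Definition pure_state n (psi : 'cV[C]_n) : Prop := (adjmx psi *m psi) = 1%:M.

Definition product_state dA dB (psi : 'cV[C]_(dA * dB)) : Prop :=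
  exists (a : 'cV[C]_dA) (b : 'cV[C]_dB), psi = a *t b.

Definition entangled dA dB (psi : 'cV[C]_(dA * dB)) : Prop :=
  ~ product_state psi.

Definition is_test n (psi : 'cV[C]_n) (E : 'M[C]_n) : Prop :=
  psd E /\ psd (1%:M - E) /\ E *m psi = psi.

Definition projective_measurement d k (P : 'I_k -> 'M[C]_d) : Prop :=
  (forall i, hermitian (P i)) /\
  (forall i j, P i *m P j = if i == j then P i else 0) /\
  \sum_(i < k) P i = 1%:M.

Record setting (dA dB : nat) := Setting {
  kA : nat;
  kB : nat;
  MA : 'I_kA -> 'M[C]_dA;
  MB : 'I_kB -> 'M[C]_dB;
  MA_proj : projective_measurement MA;
  MB_proj : projective_measurement MB }.

Definition realized_by dA dB (s : setting dA dB) (E : 'M[C]_(dA * dB)) : Prop :=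
  exists S : {set 'I_(kA s) * 'I_(kB s)},
    E = \sum_(ij in S) (@MA dA dB s ij.1 *t @MB dA dB s ij.2).

Definition eigenvalues n (A : 'M[C]_n) : seq C :=
  sval (closed_field_poly_normal (char_poly A)).

(* second largest eigenvalue (counted with multiplicity); the eigenvalues of
   the Hermitian operators considered are real and are sorted by real part.
   Convention: 0 if the space has dimension < 2. *)
Definition beta n (A : 'M[C]_n) : C :=
  nth 0 (sort (fun x y : C => 'Re y <= 'Re x) (eigenvalues A)) 1.

Definition spectral_gap n (A : 'M[C]_n) : C := 1 - beta A.

Definition verifiable_with_settings dA dB (m : nat)
    (psi : 'cV[C]_(dA * dB)) : Prop :=
  exists (settings : 'I_m -> setting dA dB) (N : nat)
         (p : 'I_N -> C) (E : 'I_N -> 'M[C]_(dA * dB)),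
    [/\ forall l, 0 < p l,
        \sum_(l < N) p l = 1,
        forall l, is_test psi (E l),
        forall l, exists t, realized_by (settings t) (E l)
      & 0 < spectral_gap (\sum_(l < N) p l *: E l)].

End Verification.

(* Main.v *)
Require Import Defs.
From HB Require Import structures.
From mathcomp Require Import all_boot all_order all_algebra.
From mathcomp Require Import complex mxtens.
Import Order.TTheory GRing.Theory Num.Theory.
Local Open Scope ring_scope.
Set Implicit Arguments. Unset Strict Implicit. Unset Printing Implicit Defensive.

(* Tests realized by projective measurements are orthogonal projectors, so a
   strategy has a positive gap iff the vectors fixed by all its tests are the
   multiples of the target.

   One setting: if all tests fix psi and (A_i (x) B_j) psi <> 0, the outcome
   (i, j) is accepted by every test, so the whole range of A_i (x) B_j is fixed;
   it contains a nonzero product vector, hence psi is a product.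

   Two settings: let M be the matrix of psi, let the rows u_i diagonalize
   M M^*, and put w_i = u_i M, which are pairwise orthogonal. The first test
   accepts when Alice's outcome u_i comes with Bob's outcome w_i; it forces
   u_i X = c_i w_i for the matrix X of a fixed vector. The second one only
   rejects when Alice obtains u = \sum_i u_i and Bob does not obtain
   w = u M = \sum_i w_i; it forces \sum_i c_i w_i = c w, so that c_i = c
   whenever w_i <> 0, and X = c M. *)

(** * Adjoints, norms and orthogonal projectors *)

Section Adjoint.
Variable R : rcfType.
Local Notation C := R[i].

Lemma adjmxE m n (A : 'M[C]_(m, n)) : adjmx A = map_mx Num.conj A^T.
Proof. by apply/matrixP => i j; rewrite !mxE. Qed.

Lemma adjmxK m n (A : 'M[C]_(m, n)) : adjmx (adjmx A) = A.
Proof. by apply/matrixP => i j; rewrite !mxE conjCK. Qed.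

Lemma adjmxM m n p (A : 'M[C]_(m, n)) (B : 'M[C]_(n, p)) :
  adjmx (A *m B) = adjmx B *m adjmx A.
Proof. by rewrite !adjmxE trmx_mul map_mxM. Qed.

Lemma adjmxB m n (A B : 'M[C]_(m, n)) : adjmx (A - B) = adjmx A - adjmx B.
Proof. by rewrite !adjmxE linearB /= map_mxB. Qed.

Lemma adjmxZ m n a (A : 'M[C]_(m, n)) : adjmx (a *: A) = a^* *: adjmx A.
Proof. by rewrite !adjmxE linearZ /= map_mxZ. Qed.

Lemma adjmx1 n : adjmx (1%:M : 'M[C]_n) = 1%:M.
Proof. by rewrite adjmxE trmx1 map_mx1. Qed.

Lemma adjmx_sum m n I (r : seq I) (P : pred I) (F : I -> 'M[C]_(m, n)) :
  adjmx (\sum_(i <- r | P i) F i) = \sum_(i <- r | P i) adjmx (F i).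
Proof.
apply/matrixP => i j; rewrite mxE !summxE rmorph_sum.
by apply: eq_bigr => k _; rewrite mxE.
Qed.

Lemma adjmx_tens m n p q (A : 'M[C]_(m, n)) (B : 'M[C]_(p, q)) :
  adjmx (A *t B) = adjmx A *t adjmx B.
Proof. by rewrite !adjmxE trmx_tens map_mxT. Qed.

Lemma sqnormE n (v : 'cV[C]_n) : (adjmx v *m v) 0 0 = \sum_i `|v i 0| ^+ 2.
Proof. by rewrite mxE; apply: eq_bigr => i _; rewrite !mxE mulrC -normCK. Qed.

Lemma sqnorm_ge0 n (v : 'cV[C]_n) : 0 <= (adjmx v *m v) 0 0.
Proof. by rewrite sqnormE sumr_ge0 // => i _; rewrite exprn_ge0. Qed.

Lemma sqnorm_eq0 n (v : 'cV[C]_n) : ((adjmx v *m v) 0 0 == 0) = (v == 0).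
Proof.
apply/idP/eqP => [|->]; last by rewrite mulmx0 mxE.
rewrite sqnormE psumr_eq0 => [/allP v0|i _]; last by rewrite exprn_ge0.
apply/colP => i; apply/eqP; rewrite !mxE -normr_eq0 -sqrf_eq0.
exact: v0 (mem_index_enum i).
Qed.

Definition orthoprojector n (P : 'M[C]_n) : Prop := Defs.hermitian P /\ P *m P = P.

Lemma orthoprojector_compl n (P : 'M[C]_n) :
  orthoprojector P -> orthoprojector (1%:M - P).
Proof.
move=> [hP PP]; split; first by rewrite /Defs.hermitian adjmxB adjmx1 hP.
by rewrite mulmxBl mul1mx mulmxBr PP mulmx1 subrr subr0.
Qed.

Lemma orthoprojector_sqnorm n (P : 'M[C]_n) (v : 'cV[C]_n) :
  orthoprojector P -> adjmx v *m P *m v = adjmx (P *m v) *m (P *m v).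
Proof. by move=> [hP PP]; rewrite adjmxM hP mulmxA -(mulmxA _ P P) PP. Qed.

Lemma orthoprojector_psd n (P : 'M[C]_n) : orthoprojector P -> psd P.
Proof.
by move=> oP; split=> [|v]; [case: oP | rewrite orthoprojector_sqnorm ?sqnorm_ge0].
Qed.

Lemma orthoprojector_test n (psi : 'cV[C]_n) (P : 'M[C]_n) :
  orthoprojector P -> P *m psi = psi -> is_test psi P.
Proof.
move=> oP Ppsi; split; first exact: orthoprojector_psd.
by split=> //; apply: orthoprojector_psd; apply: orthoprojector_compl.
Qed.

(** Spectral theorem for normal matrices; the adjoints of the rows of [U] form an orthonormal
    eigenbasis. *)
Lemma hermitian_diagonalization n (A : 'M[C]_n) : Defs.hermitian A ->
  exists2 U : 'M[C]_n, U *m adjmx U = 1%:M &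
    exists d : 'rV[C]_n, A = adjmx U *m diag_mx d *m U.
Proof.
move=> hA; have nA : A \is normalmx by apply/normalmxP; rewrite -adjmxE hA.
case/orthomx_spectral_subproof: nA => -[U d] /= uU AE; exists U.
  by rewrite adjmxE (unitarymxP uU).
by exists d; rewrite (adjmxE U) -(invmx_unitary uU).
Qed.

End Adjoint.

(** * Spectral gap and fixed vectors of a Hermitian operator *)

Section SpectralGap.
Variable R : rcfType.
Local Notation C := R[i].

Lemma le1_Re (x : C) : x <= 1 -> 'Re x = x.
Proof. by move=> x1; apply/Creal_ReP; apply: ler1_real. Qed.

(** Entries bounded by 1 are real, so sorting by real part sorts by value: if the second entry is 1,
    so is the first, and otherwise every later entry is below 1. *)
Lemma second_largest_lt1 (s : seq C) : all (fun x => x <= 1) s ->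
  (0 < 1 - nth 0 (sort (fun x y : C => 'Re y <= 'Re x) s) 1) =
  (count_mem (1%R : C) s <= 1)%N.
Proof.
set r := fun x y : C => _ => s1.
have r_total : total r by move=> x y; apply: real_leVge; apply: Creal_Re.
have r_trans : transitive r by move=> y x z xy yz; apply: le_trans yz xy.
have Re1 : 'Re (1 : C) = 1 by rewrite le1_Re.
have := sort_sorted r_total s.
rewrite -(perm_all _ (permEl (perm_sort r s))) in s1.
rewrite -(permP (permEl (perm_sort r s)) (pred1 1)).
(* With fewer than two entries [nth] returns its default 0, so the gap is 1 and the count is at most
   1. *)
case: (sort r s) s1 => [|x0 [|x1 t]] /=.
- by rewrite subr0 ltr01.
- by rewrite subr0 ltr01 addn0 leq_b1.
case/and3P=> x0_1 x1_1 t1; rewrite (path_sortedE r_trans) => /and3P[x01 x1t _].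
have Re_x : ('Re x1 = x1) * ('Re x0 = x0) by rewrite !le1_Re.
rewrite subr_gt0 lt_neqAle x1_1 andbT.
have [x1E|x1N] := eqVneq x1 1.
  move: x01; rewrite /r !Re_x x1E => x0_ge1.
  by have -> : x0 = 1 by [apply/le_anti; rewrite x0_1]; rewrite eqxx.
rewrite add0n (_ : count _ t = 0%N) ?addn0 ?leq_b1 //.
apply/eqP; rewrite -leqn0 leqNgt -has_count; apply/hasPn => y /(allP x1t).
rewrite /r Re_x => yx /=; apply/eqP => y1; rewrite y1 Re1 in yx.
by case/eqP: x1N; apply/le_anti; rewrite x1_1.
Qed.

(** Unitary conjugation preserves the characteristic polynomial, and its multiset of roots is
    unique. *)
Lemma eigenvalues_diag n (U : 'M[C]_n) (d : 'rV[C]_n) :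
  U *m adjmx U = 1%:M ->
  perm_eq (eigenvalues (adjmx U *m diag_mx d *m U)) [seq d 0 i | i : 'I_n].
Proof.
move=> UU; apply: prod_XsubC_eq; set A := _ *m _ *m _.
have := svalP (closed_field_poly_normal (char_poly A)).
rewrite -/(eigenvalues A) (monicP (char_poly_monic A)) scale1r => <-.
have UU1 : map_mx polyC (adjmx U) *m map_mx polyC U = 1%:M.
  by rewrite -map_mxM (mulmx1C UU) map_mx1.
have AE : char_poly_mx A =
    map_mx polyC (adjmx U) *m char_poly_mx (diag_mx d) *m map_mx polyC U.
  rewrite /char_poly_mx mulmxBr mulmxBl -!map_mxM; congr (_ - _).
  by rewrite scalar_mxC -mulmxA UU1 mulmx1.
rewrite /char_poly AE !det_mulmx mulrAC -det_mulmx UU1 det1 mul1r.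
rewrite -/(char_poly _) char_poly_trig ?diag_mx_is_trig //.
by rewrite big_image /=; apply: eq_bigr => i _; rewrite !mxE eqxx.
Qed.

(** In the coordinates [U *m x], fixed vectors are those supported on the indices with [d 0 i == 1].
    As all [d 0 i] are at most 1, the gap is positive iff at most one such index exists; [psi]
    supplies one. *)
Lemma hermitian_gap n (A : 'M[C]_n) (psi : 'cV[C]_n) :
  Defs.hermitian A -> psd (1%:M - A) -> psi != 0 -> A *m psi = psi ->
  0 < spectral_gap A <-> forall x : 'cV[C]_n, A *m x = x -> exists c, x = c *: psi.
Proof.
move=> hA [_ A_le1] psi0 Apsi.
have [U UU [d AE]] := hermitian_diagonalization hA.
have UU1 := mulmx1C UU.
(* [d 0 i] is a diagonal entry of U A U^*; the bound comes from testing [1%:M - A] on the adjoint of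
   row [i] of [U]. *)
have d_le1 i : d 0 i <= 1.
  have := A_le1 (adjmx (row i U)); rewrite adjmxK -row_mul.
  have -> : (row i (U *m (1%:M - A)) *m adjmx (row i U)) 0 0 =
      (U *m (1%:M - A) *m adjmx U) i i.
    by rewrite !mxE; apply: eq_bigr => k _; rewrite !mxE.
  rewrite mulmxBr mulmx1 mulmxBl UU AE !mulmxA UU mul1mx -mulmxA UU mulmx1.
  by rewrite !mxE eqxx mulr1n subr_ge0.
have fixE (x : 'cV[C]_n) :
    A *m x = x <-> forall i, (d 0 i == 1) || ((U *m x) i 0 == 0).
  have -> : A *m x = x <-> diag_mx d *m (U *m x) = U *m x.
    split=> [{2}<-|Dx]; first by rewrite AE !mulmxA UU mul1mx.
    by rewrite AE -!mulmxA Dx mulmxA UU1 mul1mx.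
  split=> [Dx i|Dx].
    have /colP/(_ i) := Dx; rewrite mul_diag_mx mxE => /eqP.
    by rewrite -subr_eq0 -{2}[(U *m x) i 0]mul1r -mulrBl mulf_eq0 subr_eq0.
  apply/colP => i; rewrite mul_diag_mx mxE.
  by have /orP[] := Dx i => /eqP ->; rewrite ?mul1r ?mulr0.
have perm_d := eigenvalues_diag d UU; rewrite -AE in perm_d.
rewrite /spectral_gap /beta second_largest_lt1; last first.
  by rewrite (perm_all _ perm_d); apply/allP => _ /imageP[i _ ->].
rewrite (permP perm_d) count_map.
have -> : count (preim (d 0) (pred1 1)) (enum 'I_n) = #|[pred i | d 0 i == 1]|.
  by rewrite cardE -size_filter enumT /enum_mem; congr size; apply: eq_filter.
split=> [/card_le1_eqP d1 x /fixE xfix|psi_spans].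
  have /fixE psi_fix := Apsi.
  have [i zi] : exists i, (U *m psi) i 0 != 0.
    apply/existsP; apply: contraNT psi0 => /existsPn z0.
    rewrite -[psi]mul1mx -UU1 -mulmxA (_ : U *m psi = 0) ?mulmx0 //.
    by apply/colP => i; have := z0 i; rewrite negbK => /eqP ->; rewrite mxE.
  have di : d 0 i == 1 by have := psi_fix i; rewrite (negPf zi) orbF.
  pose c := (U *m x) i 0 / (U *m psi) i 0; exists c.
  rewrite -[x]mul1mx -[psi in RHS]mul1mx -UU1 -!mulmxA scalemxAr; congr (_ *m _).
  apply/colP => j; rewrite [RHS]mxE; have [->|ji] := eqVneq j i; first by rewrite /c divfK.
  have dj : (d 0 j == 1) = false.
    by apply: contra_neqF ji => dj; apply: d1.
  have := xfix j; have := psi_fix j; rewrite dj /= => /eqP -> /eqP ->.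
  by rewrite mulr0.
have column i : d 0 i == 1 -> exists c, adjmx U *m delta_mx i 0 = c *: psi.
  move=> di; apply: psi_spans; apply/fixE => j; rewrite mulmxA UU mul1mx mxE.
  by have [->|] := eqVneq j i; rewrite ?di ?eqxx ?orbT.
apply/card_le1_eqP => i j /column[ci Ui] /column[cj Uj].
apply/eqP/negPn/negP => ij.
(* Two eigenvectors proportional to [psi] would be proportional to each other; both sides here equal
   [ci * cj] times [U *m psi]. *)
have e : cj *: delta_mx i 0 = ci *: delta_mx j 0 :> 'cV[C]_n.
  rewrite -[LHS]mul1mx -[RHS]mul1mx -UU -!mulmxA -!scalemxAr Ui Uj.
  by rewrite -!scalemxAr !scalerA mulrC.
have /colP/(_ j) := e; rewrite !mxE !eqxx (negPf ij) !(mulr0, mulr1) => ci0.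
have : U *m (adjmx U *m delta_mx i 0 : 'cV_n) = 0 by rewrite Ui -ci0 scale0r mulmx0.
rewrite mulmxA UU mul1mx => /colP/(_ i)/eqP.
by rewrite !mxE !eqxx oner_eq0.
Qed.

End SpectralGap.

(** * Projective measurements and the gap of a strategy *)

Section Measurements.
Variable R : rcfType.
Local Notation C := R[i].

(* Equal to 0 when [w = 0], since [0^-1 = 0]. *)
Definition row_proj n (w : 'rV[C]_n) : 'M[C]_n :=
  ((w *m adjmx w) 0 0)^-1 *: (adjmx w *m w).

Lemma row_sqnorm_eq0 n (w : 'rV[C]_n) : ((w *m adjmx w) 0 0 == 0) = (w == 0).
Proof.
rewrite -{1}[w]adjmxK sqnorm_eq0; apply/eqP/eqP => [w0|->].
  by rewrite -[w]adjmxK w0; apply/matrixP => i j; rewrite !mxE conjC0.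
by apply/matrixP => i j; rewrite !mxE conjC0.
Qed.

Lemma mul_row_proj n (v w : 'rV[C]_n) :
  v *m row_proj w = ((v *m adjmx w) 0 0 / (w *m adjmx w) 0 0) *: w.
Proof.
by rewrite -scalemxAr mulmxA {1}[v *m adjmx w]mx11_scalar mul_scalar_mx scalerA mulrC.
Qed.

Lemma row_proj_id n (w : 'rV[C]_n) : w *m row_proj w = w.
Proof.
rewrite mul_row_proj; have [->|w0] := eqVneq w 0; first by rewrite scaler0.
by rewrite divff ?scale1r ?row_sqnorm_eq0.
Qed.

Lemma row_proj_orthoprojector n (w : 'rV[C]_n) : orthoprojector (row_proj w).
Proof.
split; last by rewrite {1}/row_proj -scalemxAl -mulmxA row_proj_id.
rewrite /Defs.hermitian adjmxZ adjmxM adjmxK geC0_conj // invr_ge0.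
by rewrite -{1}[w]adjmxK sqnorm_ge0.
Qed.

Lemma row_proj_orthogonal n (v w : 'rV[C]_n) :
  v *m adjmx w = 0 -> row_proj v *m row_proj w = 0.
Proof.
move=> vw; rewrite {1}/row_proj -scalemxAl -mulmxA mul_row_proj.
have -> : (v *m adjmx w) 0 0 = 0 by rewrite vw mxE.
by rewrite mul0r scale0r mulmx0 scaler0.
Qed.

(** Used when Bob's operator acts on the matrix of a state by right multiplication with its
    transpose. *)
Lemma row_proj_conj n (w : 'rV[C]_n) : (row_proj (map_mx Num.conj w))^T = row_proj w.
Proof.
rewrite /row_proj linearZ /= trmx_mul; congr (_^-1 *: _).
  by rewrite !mxE; apply: eq_bigr => i _; rewrite !mxE conjCK mulrC.
by apply/matrixP => i j; rewrite !mxE !big_ord1 !mxE conjCK.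
Qed.

Lemma row_conj_orthogonal n (v w : 'rV[C]_n) :
  v *m adjmx w = 0 -> map_mx Num.conj v *m adjmx (map_mx Num.conj w) = 0.
Proof.
move=> vw; rewrite -[RHS](map_mx0 Num.conj) -vw map_mxM; congr (_ *m _).
by apply/matrixP => i j; rewrite !mxE.
Qed.

(* The outcome [ord0] is the complement of all the others. *)
Definition row_measurement n k (f : 'I_k -> 'rV[C]_n) (i : 'I_k.+1) : 'M[C]_n :=
  if unlift ord0 i is Some j then row_proj (f j)
  else 1%:M - \sum_j row_proj (f j).

Lemma row_measurement_lift n k (f : 'I_k -> 'rV[C]_n) j :
  row_measurement f (lift ord0 j) = row_proj (f j).
Proof. by rewrite /row_measurement liftK. Qed.

Lemma row_measurement0 n k (f : 'I_k -> 'rV[C]_n) :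
  row_measurement f ord0 = 1%:M - \sum_j row_proj (f j).
Proof. by rewrite /row_measurement unlift_none. Qed.

(** Rows may vanish and then give the zero projector. Orthogonality makes the sum [Q] absorb each
    [row_proj (f j)] on both sides, so [Q] and its complement are orthogonal projectors. *)
Lemma row_measurement_projective n k (f : 'I_k -> 'rV[C]_n) :
  (forall i j, i != j -> f i *m adjmx (f j) = 0) ->
  projective_measurement (row_measurement f).
Proof.
move=> f_orth; set Q := \sum_j row_proj (f j).
have fQ j : row_proj (f j) *m Q = row_proj (f j).
  rewrite mulmx_sumr (bigD1 j) //= big1 ?addr0 => [|i ij].
    by case: (row_proj_orthoprojector (f j)).
  by rewrite row_proj_orthogonal // f_orth // eq_sym.
have Qf j : Q *m row_proj (f j) = row_proj (f j).
  rewrite mulmx_suml (bigD1 j) //= big1 ?addr0 => [|i ij].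
    by case: (row_proj_orthoprojector (f j)).
  by rewrite row_proj_orthogonal // f_orth.
have oQ : orthoprojector Q.
  split; last by rewrite {1}/Q mulmx_suml; apply: eq_bigr => j _.
  rewrite /Defs.hermitian adjmx_sum; apply: eq_bigr => j _.
  by case: (row_proj_orthoprojector (f j)).
split; first by move=> i; case: (unliftP ord0 i) => [j|] ->;
  rewrite ?row_measurement_lift ?row_measurement0;
  [case: (row_proj_orthoprojector (f j)) | case: (orthoprojector_compl oQ)].
split=> [i j|]; last first.
  rewrite big_ord_recl row_measurement0 [X in _ + X = _](_ : _ = Q) ?subrK //.
  by apply: eq_bigr => j _; rewrite row_measurement_lift.
case: (unliftP ord0 i) => [i'|] ->; case: (unliftP ord0 j) => [j'|] ->;
  rewrite ?row_measurement_lift ?row_measurement0 ?eqxx.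
- rewrite (inj_eq lift_inj); have [->|ij] := eqVneq i' j'.
    by case: (row_proj_orthoprojector (f j')).
  by rewrite row_proj_orthogonal // f_orth.
- by rewrite mulmxBr mulmx1 fQ subrr.
- by rewrite mulmxBl mul1mx Qf subrr.
- by case: (orthoprojector_compl oQ).
Qed.

(** * Tests built from local outcomes *)

Section Local.
Variables (dA dB kA kB : nat) (PA : 'I_kA -> 'M[C]_dA) (PB : 'I_kB -> 'M[C]_dB).
Hypotheses (PA_proj : projective_measurement PA) (PB_proj : projective_measurement PB).

Lemma local_outcome_mul (S : {set 'I_kA * 'I_kB}) i j :
  (PA i *t PB j) *m (\sum_(kl in S) PA kl.1 *t PB kl.2) =
  if (i, j) \in S then PA i *t PB j else 0.
Proof.
have [_ [PA_mul _]] := PA_proj; have [_ [PB_mul _]] := PB_proj.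
have off kl : kl != (i, j) -> (PA i *t PB j) *m (PA kl.1 *t PB kl.2) = 0.
  case: kl => k l; rewrite xpair_eqE tensmx_mul PA_mul PB_mul /=.
  rewrite [i == k]eq_sym [j == l]eq_sym.
  by case: (k == i); case: (l == j) => //; rewrite ?tens0mx ?tensmx0.
rewrite mulmx_sumr; case: ifPn => ijS; last first.
  by apply: big1 => kl klS; apply: off; apply: contraNneq ijS => <-.
rewrite (bigD1 (i, j)) //= tensmx_mul PA_mul PB_mul !eqxx big1 ?addr0 //.
by move=> kl /andP[_ /off].
Qed.

Lemma local_test_orthoprojector (S : {set 'I_kA * 'I_kB}) :
  orthoprojector (\sum_(kl in S) PA kl.1 *t PB kl.2).
Proof.
have [hA _] := PA_proj; have [hB _] := PB_proj; split.
  rewrite /Defs.hermitian adjmx_sum; apply: eq_bigr => kl _.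
  by rewrite adjmx_tens hA hB.
rewrite {1}mulmx_suml; apply: eq_bigr => -[i j] ijS.
by rewrite local_outcome_mul ijS.
Qed.

Lemma local_outcomes_sum : \sum_(kl in setT) PA kl.1 *t PB kl.2 = 1%:M.
Proof.
have [_ [_ sA]] := PA_proj; have [_ [_ sB]] := PB_proj.
apply/matrixP => a b; rewrite summxE.
transitivity ((\sum_i PA i) (mxtens_unindex a).1 (mxtens_unindex b).1 *
              (\sum_j PB j) (mxtens_unindex a).2 (mxtens_unindex b).2).
  rewrite !summxE big_distrlr pair_big /=.
  by apply: eq_big => [kl|kl _]; rewrite ?inE // mxE.
rewrite sA sB !mxE -natrM mulnb.
by rewrite -(inj_eq (can_inj (@mxtens_unindexK dA dB))) -xpair_eqE.
Qed.

End Local.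

Lemma realized_by_orthoprojector dA dB (s : setting R dA dB) E :
  realized_by s E -> orthoprojector E.
Proof. by case=> S ->; apply: local_test_orthoprojector; [apply: MA_proj|apply: MB_proj]. Qed.

Lemma convex_fixed n N (p : 'I_N -> C) (E : 'I_N -> 'M[C]_n) (x : 'cV[C]_n) :
  (forall l, 0 < p l) -> \sum_l p l = 1 -> (forall l, orthoprojector (E l)) ->
  (\sum_l p l *: E l) *m x = x <-> forall l, E l *m x = x.
Proof.
move=> p0 p1 oE; split=> [Ox l|Ex]; last first.
  rewrite mulmx_suml -[RHS]scale1r -p1 scaler_suml.
  by apply: eq_bigr => l _; rewrite -scalemxAl Ex.
(* [x^* (1 - Omega) x] is the sum of the [p_l |(1 - E_l) x|^2]. *)
have xE : x = \sum_l p l *: x by rewrite -scaler_suml p1 scale1r.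
have : \sum_l p l * (adjmx ((1%:M - E l) *m x) *m ((1%:M - E l) *m x)) 0 0 = 0.
  transitivity ((adjmx x *m (x - (\sum_l p l *: E l) *m x)) 0 0).
    rewrite [X in X - _]xE mulmx_suml -sumrB mulmx_sumr summxE.
    apply: eq_bigr => k _; rewrite -orthoprojector_sqnorm; last exact: orthoprojector_compl (oE k).
    by rewrite -scalemxAl -scalerBr -scalemxAr [RHS]mxE -mulmxA mulmxBl mul1mx.
  by rewrite Ox subrr mulmx0 mxE.
move/eqP; rewrite psumr_eq0 => [/allP/(_ l (mem_index_enum l))/=|k _].
  rewrite mulf_eq0 gt_eqF //= sqnorm_eq0 mulmxBl mul1mx subr_eq0 => /eqP.
  by [].
by rewrite mulr_ge0 ?sqnorm_ge0 // ltW.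
Qed.

(** The verification operator is Hermitian and at most 1, so [hermitian_gap] applies; [convex_fixed]
    turns its fixed vectors into common fixed vectors of the tests. *)
Lemma strategy_gap n N (p : 'I_N -> C) (E : 'I_N -> 'M[C]_n) (psi : 'cV[C]_n) :
  (forall l, 0 < p l) -> \sum_l p l = 1 -> (forall l, orthoprojector (E l)) ->
  (forall l, E l *m psi = psi) -> psi != 0 ->
  0 < spectral_gap (\sum_l p l *: E l) <->
  forall x : 'cV[C]_n, (forall l, E l *m x = x) -> exists c, x = c *: psi.
Proof.
move=> p0 p1 oE Epsi psi0.
have hO : Defs.hermitian (\sum_l p l *: E l).
  rewrite /Defs.hermitian adjmx_sum; apply: eq_bigr => l _.
  by rewrite adjmxZ geC0_conj ?ltW //; case: (oE l) => ->.
have O_le1 : psd (1%:M - \sum_l p l *: E l).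
  split=> [|v]; first by rewrite /Defs.hermitian adjmxB adjmx1 hO.
  have -> : 1%:M - \sum_l p l *: E l = \sum_l p l *: (1%:M - E l).
    rewrite -[1%:M in LHS]scale1r -[X in X *: _]p1 scaler_suml -sumrB.
    by apply: eq_bigr => l _; rewrite scalerBr.
  rewrite mulmx_sumr mulmx_suml summxE sumr_ge0 // => l _.
  rewrite -scalemxAr -scalemxAl mxE mulr_ge0 //; first exact: ltW.
  by have [_ ->] := orthoprojector_psd (orthoprojector_compl (oE l)).
have Opsi := (convex_fixed psi p0 p1 oE).2 Epsi.
apply: (iff_trans (hermitian_gap hO O_le1 psi0 Opsi)).
by split=> H x /(convex_fixed x p0 p1 oE); apply: H.
Qed.

End Measurements.

(** * Verification of bipartite states *)

Section Bipartite.
Variable R : rcfType.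
Local Notation C := R[i].

Lemma pure_state_neq0 n (psi : 'cV[C]_n) : pure_state psi -> psi != 0.
Proof.
move=> /matrixP/(_ 0 0); apply: contra_eqN => /eqP->.
by rewrite mulmx0 !mxE eqxx eq_sym oner_eq0.
Qed.

(** The strategy performs one test per setting, with uniform weights. *)
Lemma strategy_verifiable dA dB m (psi : 'cV[C]_(dA * dB))
    (settings : 'I_m.+1 -> setting R dA dB) (E : 'I_m.+1 -> 'M[C]_(dA * dB)) :
  psi != 0 -> (forall l, realized_by (settings l) (E l)) ->
  (forall l, E l *m psi = psi) ->
  (forall x : 'cV[C]_(dA * dB), (forall l, E l *m x = x) -> exists c, x = c *: psi) ->
  verifiable_with_settings m.+1 psi.
Proof.
move=> psi0 E_real Epsi Efix.
have oE l : orthoprojector (E l) by apply: realized_by_orthoprojector (E_real l).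
have p0 (l : 'I_m.+1) : 0 < m.+1%:R^-1 :> C by rewrite invr_gt0 ltr0Sn.
have p1 : \sum_(l < m.+1) m.+1%:R^-1 = 1 :> C.
  by rewrite sumr_const card_ord -[_ *+ _]mulr_natr mulVf // pnatr_eq0.
exists settings, m.+1, (fun=> m.+1%:R^-1), E; split=> //.
- by move=> l; apply: orthoprojector_test.
- by move=> l; exists l.
- exact/(strategy_gap p0 p1 oE Epsi psi0).
Qed.

Lemma one_setting_product dA dB (psi : 'cV[C]_(dA * dB)) :
  psi != 0 -> verifiable_with_settings 1 psi -> product_state psi.
Proof.
move=> psi0 [s [N [p [E [p0 p1 tE rE gap]]]]].
have {}rE l : realized_by (s ord0) (E l) by have [t] := rE l; rewrite (ord1 t).
have oE l : orthoprojector (E l) by apply: realized_by_orthoprojector (rE l).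
have Epsi l : E l *m psi = psi by have [_ []] := tE l.
have /(strategy_gap p0 p1 oE Epsi psi0) fixed := gap.
pose PA := @MA R dA dB (s ord0); pose PB := @MB R dA dB (s ord0).
have [hA [PAM sA]] := MA_proj (s ord0); have [hB [PBM sB]] := MB_proj (s ord0).
(* The outcome projectors sum to the identity, so they cannot all annihilate [psi]. *)
have [[i j] Pij] : exists ij, (PA ij.1 *t PB ij.2) *m psi != 0.
  apply/existsP; apply: contraNT psi0 => /existsPn P0.
  rewrite -[psi]mul1mx -(local_outcomes_sum (MA_proj (s ord0)) (MB_proj (s ord0))).
  rewrite mulmx_suml big1 // => kl _.
  by have := P0 kl; rewrite negbK => /eqP.
(* If a test rejected [(i, j)], the product would be 0, and since [E l] fixes [psi] the outcome
   projector would annihilate [psi]. *)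
have PE l : (PA i *t PB j) *m E l = PA i *t PB j.
  have [S ES] := rE l; move: (Epsi l); rewrite {}ES => Epsi_l.
  have := local_outcome_mul (MA_proj (s ord0)) (MB_proj (s ord0)) S i j.
  case: ifP => // _ P0; move: Pij.
  by rewrite -Epsi_l mulmxA /PA /PB P0 mul0mx eqxx.
have EP l : E l *m (PA i *t PB j) = PA i *t PB j.
  rewrite -[LHS]adjmxK adjmxM adjmx_tens hA hB; case: (oE l) => -> _.
  by rewrite PE adjmx_tens hA hB.
have [[r t] rt0] : exists rt, (PA i *t PB j) rt.1 rt.2 != 0.
  apply/existsP; apply: contraNT Pij => /existsPn P0.
  rewrite (_ : _ *t _ = 0) ?mul0mx //; apply/matrixP => r t.
  by have := P0 (r, t); rewrite negbK => /eqP /= ->; rewrite mxE.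
(* Column [t] of the outcome projector is [a *t b]; its entry [r] is nonzero, whence [c != 0]
   below. *)
pose a := col (mxtens_unindex t).1 (PA i); pose b := col (mxtens_unindex t).2 (PB j).
have Pab : (PA i *t PB j) *m (a *t b) = a *t b.
  by rewrite tensmx_mul /a /b !colE !mulmxA PAM PBM !eqxx.
have [l|c abE] := fixed (a *t b); first by rewrite -Pab mulmxA EP.
have c0 : c != 0.
  apply: contraNneq rt0 => c0; move: abE; rewrite c0 scale0r => /matrixP/(_ r 0).
  by rewrite !mxE => ->.
exists (c^-1 *: a), b.
rewrite -[psi]scale1r -(mulVf c0) -scalerA -abE.
by apply/matrixP => k l; rewrite !mxE mulrA.
Qed.

(** Amplitude matrix in the product basis: Alice's operators act on it from the left, Bob's from the
    right. *)
Definition unvec dA dB (x : 'cV[C]_(dA * dB)) : 'M[C]_(dA, dB) :=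
  \matrix_(i, j) x (mxtens_index (i, j)) 0.

Lemma unvec_inj dA dB : injective (@unvec dA dB).
Proof.
move=> x y /matrixP xy; apply/colP => k; case: (mxtens_indexP k) => i j.
by have := xy i j; rewrite !mxE.
Qed.

Lemma unvec_tens dA dB (A : 'M[C]_dA) (B : 'M[C]_dB) (x : 'cV[C]_(dA * dB)) :
  unvec ((A *t B) *m x) = A *m unvec x *m B^T.
Proof.
apply/matrixP => i j; rewrite !mxE (reindex (@mxtens_index dA dB)); last first.
  by exists (@mxtens_unindex dA dB) => k _; rewrite (mxtens_indexK, mxtens_unindexK).
transitivity (\sum_a \sum_b A i a * B j b * x (mxtens_index (a, b)) 0).
  by rewrite pair_bigA; apply: eq_bigr => -[a b] _; rewrite tensmxE.
rewrite exchange_big; apply: eq_bigr => b _.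
rewrite !mxE mulr_suml; apply: eq_bigr => a _.
by rewrite !mxE mulrAC.
Qed.

Lemma unvec_sum dA dB I (r : seq I) (P : pred I) (F : I -> 'cV[C]_(dA * dB)) :
  unvec (\sum_(i <- r | P i) F i) = \sum_(i <- r | P i) unvec (F i).
Proof.
by apply/matrixP => i j; rewrite mxE !summxE; apply: eq_bigr => k _; rewrite mxE.
Qed.

Lemma row_mul_adjmx m n p (X : 'M[C]_(m, n)) (Y : 'M[C]_(p, n)) i j :
  row i X *m adjmx (row j Y) = ((X *m adjmx Y) i j)%:M.
Proof.
apply/matrixP => k l; rewrite !ord1 !mxE mulr1n.
by apply: eq_bigr => t _; rewrite !mxE.
Qed.

(** Vacuous, as ['I_1] has one element; it lets a single row define a two-outcome measurement. *)
Lemma single_row_orthogonal n (w : 'rV[C]_n) (i j : 'I_1) :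
  i != j -> w *m adjmx w = 0.
Proof. by rewrite !ord1. Qed.

Definition row_setting dA dB kA kB (f : 'I_kA -> 'rV[C]_dA) (g : 'I_kB -> 'rV[C]_dB)
    (f_orth : forall i j, i != j -> f i *m adjmx (f j) = 0)
    (g_orth : forall i j, i != j -> g i *m adjmx (g j) = 0) : setting R dA dB :=
  Setting (row_measurement_projective f_orth) (row_measurement_projective g_orth).

Lemma product_verifiable dA dB (psi : 'cV[C]_(dA * dB)) :
  psi != 0 -> product_state psi -> verifiable_with_settings 1 psi.
Proof.
move=> psi0 [a [b psiE]].
pose E := row_proj (adjmx a) *t row_proj (adjmx b).
apply: (@strategy_verifiable _ _ 0 psi
  (fun=> row_setting (@single_row_orthogonal _ (adjmx a))
                     (@single_row_orthogonal _ (adjmx b))) (fun=> E)) => //.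
- move=> _; exists [set (lift ord0 ord0, lift ord0 ord0)].
  by rewrite big_set1 /= !row_measurement_lift.
- have proj_id n (v : 'cV[C]_n) : row_proj (adjmx v) *m v = v.
    have := congr1 (@adjmx R _ _) (row_proj_id (adjmx v)).
    by rewrite adjmxM adjmxK; case: (row_proj_orthoprojector (adjmx v)) => ->.
  by move=> _; rewrite psiE; apply: etrans (tensmx_mul _ _ a b) _; rewrite !proj_id.
move=> x /(_ ord0) <-.
(* [E] is the rank-one projector onto the line of [a *t b], so [E *m x] is a multiple of [psi]. *)
have -> : E = ((adjmx a *m a) 0 0)^-1 * ((adjmx b *m b) 0 0)^-1 *:
    ((a *t b) *m (adjmx a *t adjmx b)).
  rewrite tensmx_mul /E /row_proj !adjmxK.
  by apply/matrixP => i j; rewrite !mxE mulrACA.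
pose t : 'M[C]_1 := (adjmx a *t adjmx b) *m x.
exists (((adjmx a *m a) 0 0)^-1 * ((adjmx b *m b) 0 0)^-1 * t 0 0).
rewrite -scalemxAl -[RHS]scalerA -mulmxA psiE; congr (_ *: _).
transitivity ((a *t b : 'cV_(dA * dB)) *m t) => //.
by rewrite {1}[t]mx11_scalar mul_mx_scalar.
Qed.

Lemma two_settings_verifiable dA dB (psi : 'cV[C]_(dA * dB)) :
  psi != 0 -> verifiable_with_settings 2 psi.
Proof.
move=> psi0; pose M := unvec psi.
have [|U UU [d ME]] := @hermitian_diagonalization R dA (M *m adjmx M).
  by rewrite /Defs.hermitian adjmxM adjmxK.
pose u i := row i U; pose w i := row i (U *m M).
have u_orth i j : i != j -> u i *m adjmx (u j) = 0.
  by move=> ij; rewrite row_mul_adjmx UU mxE (negPf ij) raddf0.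
(* These inner products are the off-diagonal entries of U M M^* U^*, which is [diag_mx d]: the [w i]
   are Bob's unnormalized Schmidt vectors. *)
have w_orth i j : i != j -> w i *m adjmx (w j) = 0.
  move=> ij; rewrite row_mul_adjmx adjmxM mulmxA -(mulmxA U) ME !mulmxA UU mul1mx.
  by rewrite -mulmxA UU mulmx1 mxE (negPf ij) raddf0.
pose us := \sum_i u i; pose ws := us *m M.
have wE i : w i = u i *m M by rewrite /w row_mul.
(* [unvec] turns Bob's operators into their transposes, hence the conjugates. *)
pose w' i := map_mx Num.conj (w i).
have w'_orth i j : i != j -> w' i *m adjmx (w' j) = 0.
  by move=> ij; apply: row_conj_orthogonal; apply: w_orth.
pose E1 := \sum_i row_proj (u i) *t row_proj (w' i).
pose E2 := 1%:M - row_proj us *t (1%:M - row_proj (map_mx Num.conj ws)).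
pose s1 := row_setting u_orth w'_orth.
pose s2 := row_setting (@single_row_orthogonal _ us)
                       (@single_row_orthogonal _ (map_mx Num.conj ws)).
have E1_real : realized_by s1 E1.
  exists [set (lift ord0 i, lift ord0 i) | i : 'I_dA].
  rewrite big_imset /=; last by move=> i j _ _ /(congr1 fst) /lift_inj.
  by apply: eq_bigr => i _; rewrite !row_measurement_lift.
have E2_real : realized_by s2 E2.
  (* The only rejected pair is Alice's [us] with Bob's complementary outcome [ord0]. *)
  exists [set~ (lift ord0 ord0, ord0)].
  rewrite /E2 -(local_outcomes_sum (MA_proj s2) (MB_proj s2)).
  rewrite (bigD1 (lift ord0 ord0, ord0)) //= row_measurement_lift row_measurement0.
  rewrite big_ord1 [LHS]addrC; apply: etrans (addKr _ _) _.
  by apply: eq_bigl => kl; rewrite !inE.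
have E1E x : unvec (E1 *m x) = \sum_i row_proj (u i) *m (unvec x *m row_proj (w i)).
  rewrite mulmx_suml unvec_sum; apply: eq_bigr => i _.
  by rewrite unvec_tens row_proj_conj mulmxA.
have E2E x : unvec (E2 *m x) =
    unvec x - row_proj us *m unvec x *m (1%:M - row_proj ws).
  rewrite -[row_proj ws]row_proj_conj -[X in X - _^T]trmx1 -linearB /= -unvec_tens.
  by rewrite mulmxBl mul1mx; apply/matrixP => i j; rewrite !mxE.
have row_eq (Y Z : 'M[C]_(dA, dB)) : (forall j, u j *m Y = u j *m Z) -> Y = Z.
  move=> YZ; rewrite -[Y]mul1mx -[Z]mul1mx -(mulmx1C UU) -!mulmxA; congr (_ *m _).
  by apply/row_matrixP => j; rewrite !row_mul; apply: YZ.
have row_sum j (Z : 'I_dA -> 'M[C]_(dA, dB)) :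
    u j *m (\sum_i row_proj (u i) *m Z i) = u j *m Z j.
  rewrite mulmx_sumr (bigD1 j) //= big1 ?addr0 => [|i ij].
    by rewrite mulmxA row_proj_id.
  rewrite mulmxA mul_row_proj (_ : (u j *m _) 0 0 = 0) ?mul0r ?scale0r ?mul0mx //.
  by rewrite u_orth ?mxE // eq_sym.
pose E (l : 'I_2) := if l == ord0 then E1 else E2.
apply: (@strategy_verifiable _ _ 1 psi (fun l => if l == ord0 then s1 else s2) E).
- by [].
- by move=> l; rewrite /E; case: eqP.
(* Both tests fix [psi]: [u j *m M] is [w j], fixed by its own projector, and [us *m M] is [ws],
   killed by the complement of its projector. *)
- move=> l; apply: unvec_inj; rewrite /E; case: eqP => _.
    by apply: row_eq => j; rewrite E1E row_sum mulmxA -wE row_proj_id.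
  rewrite E2E -/M {1}/row_proj -!scalemxAl -(mulmxA _ us) -/ws -mulmxA.
  by rewrite mulmxBr mulmx1 row_proj_id subrr mulmx0 scaler0 subr0.
move=> x Ex; set X := unvec x.
have E1X : \sum_i row_proj (u i) *m (X *m row_proj (w i)) = X.
  by rewrite -E1E; congr unvec; apply: (Ex ord0).
have /eqP E2X : X - row_proj us *m X *m (1%:M - row_proj ws) = X.
  by rewrite -E2E; congr unvec; apply: (Ex ord_max).
have uX i : exists c, u i *m X = c *: w i.
  by rewrite -E1X row_sum mulmxA mul_row_proj; eexists.
(* The second test forces the rejected part of [X] to vanish; multiplying it by [us] on the left
   gives [us *m X = us *m X *m row_proj ws]. *)
have [c usX] : exists c, us *m X = c *: ws.
  move: E2X; rewrite -subr_eq0 addrAC subrr sub0r oppr_eq0 => /eqP.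
  move/(congr1 (mulmx us)); rewrite !mulmxA row_proj_id mulmx0 mulmxBr mulmx1.
  by move/subr0_eq => ->; rewrite mul_row_proj; eexists.
exists c; apply: unvec_inj; apply: row_eq => j.
have -> : unvec (c *: psi) = c *: M by apply/matrixP => a b; rewrite !mxE.
rewrite -scalemxAr -wE; have [cj ujX] := uX j; rewrite ujX.
have [->|wj0] := eqVneq (w j) 0; first by rewrite !scaler0.
(* Pairing [us *m X = c *: ws] with [w j] isolates the index [j] on both sides by orthogonality, and
   [w j != 0] then yields [cj = c]. *)
have wsw : ws *m adjmx (w j) = w j *m adjmx (w j).
  rewrite /ws /us !mulmx_suml (bigD1 j) //= big1 ?addr0 -?wE // => i ij.
  by rewrite -wE w_orth.
have usw : us *m X *m adjmx (w j) = u j *m X *m adjmx (w j).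
  rewrite /us !mulmx_suml (bigD1 j) //= big1 ?addr0 // => i ij.
  by have [ci ->] := uX i; rewrite -scalemxAl w_orth // scaler0.
move: usw; rewrite usX ujX -!scalemxAl wsw => /matrixP/(_ 0 0).
rewrite [LHS]mxE [RHS]mxE => /(mulIf _) ->//.
by rewrite row_sqnorm_eq0.
Qed.

End Bipartite.

Theorem theorem1 (R : rcfType) (dA dB : nat) (hA : (0 < dA)%N) (hB : (0 < dB)%N) :
  (forall psi : 'cV[R[i]]_(dA * dB), pure_state psi -> product_state psi ->
     verifiable_with_settings 1 psi) /\
  (forall psi : 'cV[R[i]]_(dA * dB), pure_state psi -> entangled psi ->
     verifiable_with_settings 2 psi /\ ~ verifiable_with_settings 1 psi).
Proof.
split=> psi /pure_state_neq0 psi0 psi_cor; first exact: product_verifiable.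
split; first exact: two_settings_verifiable.
by move=> ver1; apply: psi_cor; apply: one_setting_product.
Qed.
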